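(* Let $(M,g)$ be a Riemannian $n$-manifold and let $k$ be an integer such that $0\leq k\leq n-1$. If $\mathrm{Ein}_k>0$, then at each point the Ricci curvature has at least $k+1$ positive eigenvalues (counted with multiplicity).
   Context: $\mathrm{Ein}_k:=\mathrm{Scal}\cdot g-k\,\mathrm{Ric}$, with $\mathrm{Ric}$ and $\mathrm{Scal}$ the Ricci tensor and scalar curvature of $g$; $\mathrm{Ein}_k>0$ means positive definite at every point. Eigenvalues of $\mathrm{Ric}$ are taken with respect to $g$. *)

(* Defs.v *)
From HB Require Import structures.
From mathcomp Require Import all_boot all_order all_algebra.
From mathcomp Require Import all_classical all_reals all_analysis.
From mathcomp Require polyrcf.

Set Implicit Arguments.
Unset Strict Implicit.
Unset Printing Implicit Defensive.

Import Order.TTheory GRing.Theory Num.Theory.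
Import numFieldNormedType.Exports.

Local Open Scope classical_set_scope.
Local Open Scope ring_scope.

(* R^n is 'rV[R]_n, so matrices act on the right of (row) vectors. *)

Section Calculus.
Context {R : realType} {n : nat}.

Definition partial {V : normedModType R} (i : 'I_n) (f : 'rV[R]_n -> V)
  : 'rV[R]_n -> V := 'D_(delta_mx 0 i) f.

(* U is meant to be open, so that f is continuous or derivable at a point of U
   independently of its values outside U. *)
Fixpoint continuously_differentiable {V : normedModType R} (r : nat)
    (U : set 'rV[R]_n) (f : 'rV[R]_n -> V) : Prop :=
  {in U, continuous f} /\
  if r is r'.+1 then
    forall i : 'I_n, {in U, forall x, derivable f x (delta_mx 0 i)} /\
                     continuously_differentiable r' U (partial i f)
  else True.

Definition smooth {V : normedModType R} (U : set 'rV[R]_n)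
  (f : 'rV[R]_n -> V) : Prop :=
  forall r, continuously_differentiable r U f.

End Calculus.

Section LinearAlgebra.
Context {R : realType} {n : nat}.

(* Positivity of the quadratic form; symmetry is not part of the definition. *)
Definition positive_definite (A : 'M[R]_n) : Prop :=
  forall v : 'rV[R]_n, v != 0 -> 0 < (v *m A *m v^T) 0 0.

(* The number of positive eigenvalues, with algebraic multiplicity;
   rootsR enumerates the real roots of a polynomial without repetition. *)
Definition num_positive_eigenvalues (A : 'M[R]_n) : nat :=
  (\sum_(x <- polyrcf.rootsR (char_poly A) | (0 < x)%R) mup x (char_poly A))%N.

End LinearAlgebra.

Record chart (R : realType) (n : nat) (M : topologicalType) := Chart {
  chart_dom : set M ;
  chart_map : M -> 'rV[R]_n ;
  chart_inv : 'rV[R]_n -> M ;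
  chart_dom_open : open chart_dom ;
  chart_image_open : open (chart_map @` chart_dom) ;
  chart_mapK : {in chart_dom, cancel chart_map chart_inv} ;
  chart_map_continuous : {in chart_dom, continuous chart_map} ;
  chart_inv_continuous : {in chart_map @` chart_dom, continuous chart_inv}
}.

Definition chart_image (R : realType) (n : nat) (M : topologicalType)
  (a : chart R n M) : set 'rV[R]_n := chart_map a @` chart_dom a.

Definition overlap (R : realType) (n : nat) (M : topologicalType)
  (a b : chart R n M) : set 'rV[R]_n :=
  chart_map a @` (chart_dom a `&` chart_dom b).

Definition transition (R : realType) (n : nat) (M : topologicalType)
  (a b : chart R n M) : 'rV[R]_n -> 'rV[R]_n := chart_map b \o chart_inv a.

Record smooth_manifold (R : realType) (n : nat) := SmoothManifold {
  manifold_space :> topologicalType ;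
  manifold_hausdorff : hausdorff_space manifold_space ;
  manifold_second_countable : @second_countable manifold_space ;
  atlas : set (chart R n manifold_space) ;
  atlas_cover : forall p : manifold_space,
    exists2 a, atlas a & chart_dom a p ;
  atlas_smooth : forall a b, atlas a -> atlas b ->
    smooth (overlap a b) (transition a b)
}.

(* A metric is given by its components g_ij in each chart; the last condition
   is the transformation law of a (0,2)-tensor. *)
Record riemannian_metric (R : realType) (n : nat) (M : smooth_manifold R n) :=
  RiemannianMetric {
  metric :> chart R n M -> 'rV[R]_n -> 'M[R]_n ;
  metric_smooth : forall a, atlas a -> smooth (chart_image a) (metric a) ;
  metric_symmetric : forall a x, atlas a -> chart_image a x ->
    (metric a x)^T = metric a x ;
  metric_positive : forall a x, atlas a -> chart_image a x ->
    positive_definite (metric a x) ;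
  metric_transition : forall a b x, atlas a -> atlas b -> overlap a b x ->
    metric a x =
      'J (transition a b) x *m metric b (transition a b x)
      *m ('J (transition a b) x)^T
}.

(* The classical coordinate expressions, for a metric h = (h_ij) on an open
   subset of R^n. *)
Section Curvature.
Context {R : realType} {n : nat} (h : 'rV[R]_n -> 'M[R]_n).

(* Gamma^l_ij *)
Definition christoffel (l i j : 'I_n) (x : 'rV[R]_n) : R :=
  2^-1 * \sum_(m < n) invmx (h x) l m *
    (partial i (fun y => h y j m) x + partial j (fun y => h y i m) x
     - partial m (fun y => h y i j) x).

(* The coefficient of e_l in R(e_i, e_j) e_k, where
   R(X, Y) Z = D_X D_Y Z - D_Y D_X Z - D_[X,Y] Z. *)
Definition riemann (l k i j : 'I_n) (x : 'rV[R]_n) : R :=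
  partial i (christoffel l j k) x - partial j (christoffel l i k) x
  + \sum_(m < n) (christoffel l i m x * christoffel m j k x
                  - christoffel l j m x * christoffel m i k x).

(* Ric(Y, Z) is the trace of X |-> R(X, Y) Z. *)
Definition ricci (x : 'rV[R]_n) : 'M[R]_n :=
  \matrix_(j, k) \sum_(i < n) riemann i k i j x.

(* The matrix of Ric with respect to h: v is an eigenvector for the
   eigenvalue c iff Ric(v, -) = c h(v, -). *)
Definition ricci_operator (x : 'rV[R]_n) : 'M[R]_n := ricci x *m invmx (h x).

Definition scal (x : 'rV[R]_n) : R := \tr (ricci_operator x).

Definition ein (k : nat) (x : 'rV[R]_n) : 'M[R]_n :=
  scal x *: h x - k%:R *: ricci x.

End Curvature.

Definition ein_positive (R : realType) (n : nat) (M : smooth_manifold R n)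
  (g : riemannian_metric M) (k : nat) : Prop :=
  forall (p : M) (a : chart R n M), atlas a -> chart_dom a p ->
    positive_definite (ein (g a) k (chart_map a p)).

(* Main.v *)
Require Import Defs.
From mathcomp Require Import all_boot all_order all_algebra.
From mathcomp Require Import all_classical all_reals all_analysis.
From mathcomp Require polyrcf.
From mathcomp Require Import complex lra.

(* At a point, let l_1, ..., l_n be the eigenvalues of Ric and s their sum, the
   scalar curvature. Evaluating Ein_k on eigenvectors gives k l_i < s for all i.
   Summing over all i yields (n - k) s > 0, so s > 0; summing over the r indices
   with l_i > 0, whose sum is at least s, yields k s < r s, so k < r.

   All eigenvalues are real because Ric is symmetric. For the coordinate
   expression, where no symmetry is built in, this follows from
   \sum_i Gamma^i_ik = tr (h^-1 d_k h) / 2 and the equality of mixed partial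
   derivatives of h. *)

Set Implicit Arguments.
Unset Strict Implicit.
Unset Printing Implicit Defensive.

Import Order.TTheory GRing.Theory Num.Theory.
Import numFieldNormedType.Exports.

Local Open Scope classical_set_scope.
Local Open Scope ring_scope.

(** * Eigenvalues of a symmetric pencil *)

Lemma map_Re_mulmx (R : rcfType) (m n p : nat) (v : 'M[R[i]]_(m, n))
    (A : 'M[R]_(n, p)) :
  map_mx (@complex.Re R) (v *m map_mx (real_complex R) A) =
  map_mx (@complex.Re R) v *m A.
Proof.
apply/matrixP => i j; rewrite !mxE raddf_sum; apply: eq_bigr => l _.
by rewrite !mxE; case: (v i l) => a b /=; rewrite mulr0 subr0.
Qed.

Lemma map_Im_mulmx (R : rcfType) (m n p : nat) (v : 'M[R[i]]_(m, n))
    (A : 'M[R]_(n, p)) :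
  map_mx (@complex.Im R) (v *m map_mx (real_complex R) A) =
  map_mx (@complex.Im R) v *m A.
Proof.
apply/matrixP => i j; rewrite !mxE raddf_sum; apply: eq_bigr => l _.
by rewrite !mxE; case: (v i l) => a b /=; rewrite mulr0 add0r.
Qed.

Lemma bilinear_form_sym (R : comPzRingType) (n : nat) (A : 'M[R]_n)
    (u v : 'rV[R]_n) :
  A^T = A -> u *m A *m v^T = v *m A *m u^T.
Proof.
move=> sA; have <- : (v *m A *m u^T)^T = u *m A *m v^T.
  by rewrite !trmx_mul trmxK sA mulmxA.
by apply/matrixP => i j; rewrite !ord1 mxE.
Qed.

Lemma positive_definite_unitmx (R : realType) (n : nat) (A : 'M[R]_n) :
  positive_definite A -> A \in unitmx.
Proof.
move=> pA; rewrite -row_free_unit -kermx_eq0; apply/rowV0P => v /sub_kermxP vA.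
by apply/eqP; apply/negPn/negP => /pA; rewrite vA mul0mx mxE ltxx.
Qed.

(* For a complex left eigenvector a + i b of S G^-1 with eigenvalue x + i y,
   symmetry of S and G gives y (a G a^T + b G b^T) = 0. *)
Lemma symmetric_pencil_eigenvalue_real (R : realType) (n : nat)
    (S G : 'M[R]_n) (z : R[i]) :
  S^T = S -> G^T = G -> positive_definite G ->
  eigenvalue (map_mx (real_complex R) (S *m invmx G)) z -> complex.Im z = 0.
Proof.
move=> sS sG pG /eigenvalueP[v vE vn0].
have uG := positive_definite_unitmx pG.
pose a := map_mx (@complex.Re R) v; pose b := map_mx (@complex.Im R) v.
(* Multiplying the eigenvector equation by [G] on the right cancels [invmx G]. Its real part gives
   this identity, its imaginary part the next one. *)
have aE : a *m S = complex.Re z *: (a *m G) - complex.Im z *: (b *m G).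
  have := congr1 (fun w => map_mx (@complex.Re R) w *m G) vE.
  rewrite map_Re_mulmx -!mulmxA mulVmx// mulmx1 -/a => ->.
  rewrite !scalemxAl -mulmxBl; congr (_ *m _).
  by apply/rowP => j; rewrite !mxE; case: z {vE} => ? ?; case: (v 0 j).
have bE : b *m S = complex.Re z *: (b *m G) + complex.Im z *: (a *m G).
  have := congr1 (fun w => map_mx (@complex.Im R) w *m G) vE.
  rewrite map_Im_mulmx -!mulmxA mulVmx// mulmx1 -/b => ->.
  rewrite !scalemxAl -mulmxDl; congr (_ *m _).
  by apply/rowP => j; rewrite !mxE; case: z {vE aE} => ? ?; case: (v 0 j).
have q0 : 0 < (a *m G *m a^T) 0 0 + (b *m G *m b^T) 0 0.
  have q_ge0 (w : 'rV[R]_n) : 0 <= (w *m G *m w^T) 0 0.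
    by have [->|/pG/ltW//] := eqVneq w 0; rewrite !mul0mx mxE.
  have [a0|/pG a0] := eqVneq a 0; last by rewrite ltr_pwDl.
  have [b0|/pG b0] := eqVneq b 0; last by rewrite ltr_wpDl.
  case/eqP: vn0; apply/rowP => j; move/rowP/(_ j): a0; move/rowP/(_ j): b0.
  by rewrite !mxE; case: (v 0 j) => ? ? /= -> ->.
(* After substitution the terms in [complex.Re z] cancel by symmetry of [G], and only the multiple
   of [complex.Im z] survives. *)
have := bilinear_form_sym a b sS.
rewrite aE bE mulmxBl mulmxDl -!scalemxAl (bilinear_form_sym a b sG).
move/(congr1 (fun M : 'M[R]_1 => M 0 0)); rewrite !mxE => e.
have /eqP : complex.Im z * ((a *m G *m a^T) 0 0 + (b *m G *m b^T) 0 0) = 0.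
  by rewrite !mxE; lra.
by rewrite mulf_eq0 (gt_eqF q0) orbF => /eqP.
Qed.

(** The characteristic polynomial splits over the algebraically closed field [R[i]]. Its roots there
    are eigenvalues, hence real, so the factorization descends to [R]. *)
Lemma char_poly_symmetric_pencil (R : realType) (n : nat) (S G : 'M[R]_n) :
  S^T = S -> G^T = G -> positive_definite G ->
  exists rs : seq R,
    char_poly (S *m invmx G) = \prod_(z <- rs) ('X - z%:P).
Proof.
move=> sS sG pG; set A := S *m invmx G.
have [rs] := closed_field_poly_normal (char_poly (map_mx (real_complex R) A)).
rewrite (monicP (char_poly_monic _)) scale1r => prs.
exists (map (@complex.Re R) rs); apply: (@map_poly_inj _ _ (real_complex R)).
rewrite -map_char_poly /= in prs *; rewrite prs rmorph_prod big_map.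
apply: eq_big_seq => z zrs; rewrite rmorphB /= map_polyX map_polyC /=.
congr ('X - _%:P); apply/eqP; rewrite eq_complex /= eqxx /=.
rewrite (@symmetric_pencil_eigenvalue_real _ _ S G)//.
by rewrite eigenvalue_root_char -map_char_poly prs root_prod_XsubC.
Qed.

(** The multiplicity of a root is its number of occurrences in [rs]. Exchanging the two sums, each
    positive entry of [rs] is counted once, at the distinct root equal to it. *)
Lemma num_positive_eigenvalues_split (R : realType) (n : nat) (A : 'M[R]_n)
    (rs : seq R) :
  char_poly A = \prod_(z <- rs) ('X - z%:P) ->
  num_positive_eigenvalues A = count (> 0) rs.
Proof.
move=> Ars; have An0 : char_poly A != 0 by rewrite monic_neq0// char_poly_monic.
have rootsE x : (x \in polyrcf.rootsR (char_poly A)) = (x \in rs).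
  have := polyrcf.roots_on_rootsR An0 x.
  by rewrite in_itv /= Ars root_prod_XsubC => <-.
rewrite /num_positive_eigenvalues.
under eq_bigr do rewrite Ars mu_prod_XsubC -size_filter -sum1_size big_filter.
rewrite -sum1_count (exchange_big_dep (> 0))/=; last first.
  by move=> i j i0 /eqP ->.
rewrite big_seq_cond [RHS]big_seq_cond; apply: eq_bigr => j /andP[jrs j0].
rewrite (eq_bigl (pred1 j)) => [|i /=]; last first.
  by rewrite eq_sym; case: eqP => [->|]; rewrite ?j0 ?andbF.
rewrite -big_filter filter_pred1_uniq ?big_seq1 ?rootsE//.
exact: polyrcf.uniq_roots.
Qed.

(** Both sides are, up to sign, the coefficient of degree [n.-1] of the characteristic
    polynomial. *)
Lemma mxtrace_split (R : idomainType) (n : nat) (A : 'M[R]_n) (rs : seq R) :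
  char_poly A = \prod_(z <- rs) ('X - z%:P) -> \tr A = \sum_(z <- rs) z.
Proof.
move=> Ars; have srs : size rs = n.
  by apply: succn_inj; rewrite -(size_prod_XsubC rs id) -Ars size_char_poly.
(* For [n = 0] the coefficient of index [n.-1] would be the leading one; here both sides are empty
   sums. *)
have [n0|n0] := posnP n.
  move: rs srs {Ars} A; rewrite n0 => -[]// _ A.
  by rewrite big_nil /mxtrace big_ord0.
apply: oppr_inj; rewrite -char_poly_trace// Ars -srs coefPn_prod_XsubC//.
by rewrite srs -lt0n.
Qed.

Lemma count_pos_gt (R : realDomainType) (k : nat) (rs : seq R) :
  (k < size rs)%N -> {in rs, forall z, k%:R * z < \sum_(y <- rs) y} ->
  (k < count (> 0)%R rs)%N.
Proof.
move=> krs; set s := \sum_(y <- rs) y => rsk.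
have sum_cst (P : pred R) : \sum_(z <- rs | P z) s = (count P rs)%:R * s.
  by rewrite big_const_seq iter_addr_0 mulr_natl.
(* Some entry must satisfy [P] for the summed inequality to remain strict. *)
have lt_sum (P : pred R) : has P rs ->
    k%:R * \sum_(z <- rs | P z) z < (count P rs)%:R * s.
  move=> /hasP[z zrs Pz]; rewrite -sum_cst mulr_sumr big_seq_cond.
  rewrite [ltRHS]big_seq_cond ltr_sum//; last by move=> y /andP[/rsk].
  by apply/hasP; exists z => //; rewrite zrs.
have s0 : 0 < s.
  have := lt_sum predT; rewrite has_predT (leq_trans _ krs)// => /(_ isT).
  rewrite -/s count_predT -subr_gt0 -mulrBl -natrB 1?ltnW//.
  by rewrite pmulr_rgt0// ltr0n subn_gt0.
have sP : s <= \sum_(z <- rs | 0 < z) z.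
  rewrite /s [X in X <= _](bigID (> 0))/= gerDl.
  by apply: sumr_le0 => z; rewrite -leNgt.
(* Without a positive entry the right side of [sP] would be an empty sum, against [s0]. *)
have hpos : has (> 0) rs.
  apply: contraTT (lt_le_trans s0 sP) => /hasPn hrs.
  by rewrite big_seq_cond big1 ?ltxx// => z /andP[/hrs/negP].
have := le_lt_trans (ler_wpM2l (ler0n _ k) sP) (lt_sum _ hpos).
by rewrite ltr_pM2r// ltr_nat.
Qed.

(** An eigenvector [v] for [z] satisfies [v *m S = z *: (v *m G)], so the form assumed positive
    takes at [v] the value of [G] at [v] times [\tr (S *m invmx G) - k%:R * z]. This factor is
    therefore positive, as [count_pos_gt] requires. *)
Lemma num_positive_eigenvalues_pencil (R : realType) (n k : nat)
    (S G : 'M[R]_n) :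
  S^T = S -> G^T = G -> positive_definite G -> (k < n)%N ->
  positive_definite (\tr (S *m invmx G) *: G - k%:R *: S) ->
  (k < num_positive_eigenvalues (S *m invmx G))%N.
Proof.
move=> sS sG pG kn pE; have [rs Ars] := char_poly_symmetric_pencil sS sG pG.
have srs : size rs = n.
  by apply: succn_inj; rewrite -(size_prod_XsubC rs id) -Ars size_char_poly.
rewrite (num_positive_eigenvalues_split Ars); apply: count_pos_gt.
  by rewrite srs.
move=> z zrs; rewrite -(mxtrace_split Ars).
have /eigenvalueP[v vE vn0] : eigenvalue (S *m invmx G) z.
  by rewrite eigenvalue_root_char Ars root_prod_XsubC.
have vS : v *m S = z *: (v *m G).
  by rewrite scalemxAl -vE -!mulmxA mulVmx ?mulmx1// positive_definite_unitmx.
have := pE _ vn0; rewrite mulmxBr -!scalemxAr vS mulmxBl -!scalemxAl scalerA.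
by rewrite -scalerBl mxE pmulr_lgt0 ?subr_gt0// pG.
Qed.

(** * Equality of mixed partial derivatives *)

(** The two difference quotients coincide, which reduces directional derivatives to functions of one
    real variable. *)
Lemma derive_line (R : realType) (V W : normedModType R) (f : V -> W) (df : W)
    (x u : V) (t : R) :
  is_derive (t *: u + x) u f df ->
  is_derive t 1 (fun s : R => f (s *: u + x)) df.
Proof.
have E : (fun h : R => h^-1 *: (f (h *: u + (t *: u + x)) - f (t *: u + x))) =
    (fun h : R => h^-1 *: (f ((h *: 1 + t) *: u + x) - f (t *: u + x))).
  by apply/funext => h; rewrite addrA scalerDl [h *: 1]mulr1.
move=> [fu <-]; apply: DeriveDef; first by move: fu; rewrite /derivable /= E.
by rewrite /derive /= E.
Qed.

Lemma mvt_line (R : realType) (V : normedModType R) (f : V -> R)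
    (df : R -> R) (x u : V) (t : R) : 0 < t ->
  (forall s, 0 <= s <= t -> is_derive (s *: u + x) u f (df s)) ->
  exists2 s, 0 <= s <= t & f (t *: u + x) - f x = t * df s.
Proof.
move=> t0 dfs.
have [||c] := @MVT R (fun s => f (s *: u + x)) df 0 t t0.
- by move=> s; rewrite in_itv => /andP[s0 st]; apply: derive_line;
    apply: dfs; rewrite !ltW.
- apply: derivable_within_continuous => s; rewrite in_itv => /dfs ds.
  by have [] := derive_line ds.
rewrite in_itv scale0r add0r subr0 mulrC => /andP[c0 ct] ->.
by exists c => //; rewrite !ltW.
Qed.

(** The mean value theorem is applied twice: along [u] to the increment of [f] by [t *: v], then
    along [v] to [fu]. The set [B] need only contain the parallelogram spanned at [x] by [t *: u]
    and [t *: v]. *)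
Lemma second_difference (R : realType) (V : normedModType R)
    (f fu fuv : V -> R) (x u v : V) (t : R) (B : set V) : 0 < t ->
  (forall a b, 0 <= a <= t -> 0 <= b <= t -> B (a *: u + (b *: v + x))) ->
  (forall y, B y -> is_derive y u f (fu y)) ->
  (forall y, B y -> is_derive y v fu (fuv y)) ->
  exists2 y, B y & f (t *: u + (t *: v + x)) - f (t *: u + x)
                   - (f (t *: v + x) - f x) = t ^+ 2 * fuv y.
Proof.
move=> t0 tB dfu dfuv.
have z0t : 0 <= (0 : R) <= t by rewrite lexx ltW.
have tt : 0 <= t <= t by rewrite lexx ltW.
have tB0 a : 0 <= a <= t -> B (a *: u + x).
  by move=> /tB /(_ z0t); rewrite scale0r add0r.
pose g y := f (y + t *: v) - f y.
have dshift y : B (y + t *: v) ->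
    is_derive y u (fun z => f (z + t *: v)) (fu (y + t *: v)).
  move=> /dfu [df <-]; apply: DeriveDef.
    by move: df; rewrite /derivable /=; under eq_fun do rewrite addrA.
  by rewrite /derive /=; under eq_fun do rewrite -addrA.
have dg a : 0 <= a <= t ->
    is_derive (a *: u + x) u g (fu (a *: u + x + t *: v) - fu (a *: u + x)).
  move=> at0; apply: is_deriveB; last exact/dfu/tB0.
  by apply: dshift; rewrite -addrA [x + _]addrC; exact: tB.
have [a at0] := mvt_line t0 dg.
rewrite -[a *: u + x + _]addrC => gE.
have [|b bt0 bE] := @mvt_line _ _ fu (fun b => fuv (b *: v + (a *: u + x)))
    (a *: u + x) v t t0.
  by move=> b bt0; apply: dfuv; rewrite addrCA; exact: tB.
exists (b *: v + (a *: u + x)); first by rewrite addrCA; exact: tB.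
rewrite expr2 -mulrA -bE -gE /g.
by rewrite -[t *: u + x + _]addrA [x + _]addrC.
Qed.

(** The second difference is symmetric in [u] and [v], so it is [t ^+ 2] times a value of [fuv] and
    also [t ^+ 2] times a value of [fvu], at points near [x]. Continuity at [x] then makes [fuv x]
    and [fvu x] differ by at most any [e > 0]. *)
Lemma schwarz_derive (R : realType) (V : normedModType R)
    (f fu fv fuv fvu : V -> R) (x u v : V) (U : set V) : open U -> U x ->
  (forall y, U y -> is_derive y u f (fu y)) ->
  (forall y, U y -> is_derive y v f (fv y)) ->
  (forall y, U y -> is_derive y v fu (fuv y)) ->
  (forall y, U y -> is_derive y u fv (fvu y)) ->
  {for x, continuous fuv} -> {for x, continuous fvu} -> fuv x = fvu x.
Proof.
move=> oU Ux dfu dfv dfuv dfvu cuv cvu; apply/eqP; rewrite -subr_eq0 -normr_le0.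
apply/ler_addgt0Pr => e e0; rewrite add0r.
have e20 : 0 < e / 2 by rewrite divr_gt0.
have : \forall y \near x,
    [/\ U y, `|fuv x - fuv y| < e / 2 & `|fvu x - fvu y| < e / 2].
  move/cvgrPdist_lt : cuv => /(_ _ e20).
  move/cvgrPdist_lt : cvu => /(_ _ e20).
  by apply: filterS3 (open_nbhs_nbhs (conj oU Ux)) => y.
move=> /nbhs_normP[r /= r0 xr].
pose B : set V := ball_ Num.norm x r.
(* This size keeps the parallelogram within distance [r / 2] of [x]; the summand 1 keeps the
   denominator positive when [u] and [v] both vanish. *)
pose t := r / 2 / (`|u| + `|v| + 1).
have n0 : 0 < `|u| + `|v| + 1 by rewrite ltr_wpDl// addr_ge0.
have t0 : 0 < t by rewrite !divr_gt0.
(* The directions are generalized so that the bound serves both orders of [u] and [v]. *)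
have tB u' v' : `|u'| + `|v'| = `|u| + `|v| -> forall a b,
    0 <= a <= t -> 0 <= b <= t -> B (a *: u' + (b *: v' + x)).
  move=> E a b /andP[a0 ta] /andP[b0 tb]; rewrite /B /ball_ /=.
  rewrite addrA opprD addrCA subrr addr0 normrN.
  rewrite (le_lt_trans (ler_normD _ _))// !normrZ !ger0_norm//.
  rewrite (@le_lt_trans _ _ (t * (`|u| + `|v|)))//.
    by rewrite -E mulrDr lerD// ler_wpM2r.
  rewrite (@lt_trans _ _ (t * (`|u| + `|v| + 1)))//.
    by rewrite ltr_pM2l// ltrDl.
  by rewrite /t divfK ?gt_eqF// ltr_pdivrMr// ltr_pMr// ltr1n.
have xU y : B y -> U y by case/xr.
have [y By yE] := second_difference t0 (tB u v erefl)
  (fun y By => dfu y (xU y By)) (fun y By => dfuv y (xU y By)).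
have [z Bz zE] := second_difference t0 (tB v u (addrC _ _))
  (fun y By => dfv y (xU y By)) (fun y By => dfvu y (xU y By)).
have yz : fuv y = fvu z.
  apply: (mulfI (x := t ^+ 2)); first by rewrite expf_neq0// gt_eqF.
  by rewrite -yE -zE [t *: v + (_ + _)]addrCA !opprD addrACA.
have [_ yx _] := xr y By; have [_ _ zx] := xr z Bz.
rewrite -(subrKA (fuv y)) [e]splitr {2}yz.
by rewrite (le_trans (ler_normD _ _))// lerD ?ltW// distrC.
Qed.

(** * Derivatives of matrix-valued functions *)

Lemma is_derive_sum_fun (R : realFieldType) (V : normedModType R) (n : nat)
    (F : 'I_n -> V -> R) (dF : 'I_n -> R) (x v : V) :
  (forall i, is_derive x v (F i) (dF i)) ->
  is_derive x v (fun y => \sum_(i < n) F i y) (\sum_(i < n) dF i).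
Proof. by move=> dFx; rewrite -fct_sumE; exact: is_derive_sum. Qed.

Lemma derivable_sum_seq (R : realFieldType) (V : normedModType R) (I : Type)
    (r : seq I) (P : pred I) (F : I -> V -> R) (x v : V) :
  (forall i, derivable (F i) x v) ->
  derivable (fun y => \sum_(i <- r | P i) F i y) x v.
Proof.
move=> dF; elim: r => [|i r IH].
  by under eq_fun do rewrite big_nil; exact: derivable_cst.
under eq_fun do rewrite big_cons; case: (P i) => //.
exact: derivableD.
Qed.

Lemma derivable_prod_seq (R : realFieldType) (V : normedModType R) (I : Type)
    (r : seq I) (P : pred I) (F : I -> V -> R) (x v : V) :
  (forall i, derivable (F i) x v) ->
  derivable (fun y => \prod_(i <- r | P i) F i y) x v.
Proof.
move=> dF; elim: r => [|i r IH].
  by under eq_fun do rewrite big_nil; exact: derivable_cst.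
under eq_fun do rewrite big_cons; case: (P i) => //.
exact: derivableM.
Qed.

Lemma derivable_det (R : realFieldType) (V : normedModType R) (n : nat)
    (A : V -> 'M[R]_n) (x v : V) :
  derivable A x v -> derivable (fun y => \det (A y)) x v.
Proof.
move=> /derivable_mxP dA; apply: derivable_sum_seq => s.
by apply: derivableM; [exact: derivable_cst | exact: derivable_prod_seq].
Qed.

(** Near [x] the inverse is the adjugate divided by the determinant, both polynomial in the entries.
    Invertibility is required on a neighbourhood because [invmx] returns a singular matrix
    unchanged. *)
Lemma derivable_invmx (R : realFieldType) (V : normedModType R) (n : nat)
    (A : V -> 'M[R]_n) (x v : V) :
  derivable A x v -> (\forall y \near x, A y \in unitmx) ->
  derivable (fun y => invmx (A y)) x v.
Proof.
move=> dA uA.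
apply: (@near_eq_derivable _ _ _ (fun y => (\det (A y))^-1 *: \adj (A y))).
  by apply: filterS uA => y uy; rewrite /invmx uy.
apply/derivable_mxP => i j; under eq_fun do rewrite !mxE.
apply: derivableM.
  apply: derivableV; last exact: derivable_det.
  by rewrite -unitfE -unitmxE; exact: nbhs_singleton uA.
apply: derivableM; first exact: derivable_cst.
apply: derivable_det; apply/derivable_mxP => k l; under eq_fun do rewrite !mxE.
by move/derivable_mxP: dA; exact.
Qed.

Lemma derive_mx_coord (R : realFieldType) (V : normedModType R) (m n : nat)
    (A : V -> 'M[R]_(m, n)) (x v : V) (i : 'I_m) (j : 'I_n) :
  derivable A x v -> 'D_v (fun y => A y i j) x = ('D_v A x) i j.
Proof. by move=> dA; rewrite (derive_mx dA) mxE. Qed.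

Lemma is_derive_mxP (R : realFieldType) (V : normedModType R) (m n : nat)
    (A : V -> 'M[R]_(m, n)) (dA : 'M[R]_(m, n)) (x v : V) :
  is_derive x v A dA <->
  forall i j, is_derive x v (fun y => A y i j) (dA i j).
Proof.
split=> [[dAx <-] i j|dAx].
  by apply: DeriveDef; [move/derivable_mxP: dAx; exact|exact: derive_mx_coord].
have dA' : derivable A x v by apply/derivable_mxP => i j; have [] := dAx i j.
apply: DeriveDef => //; apply/matrixP => i j.
by rewrite -derive_mx_coord//; have [] := dAx i j.
Qed.

Lemma is_derive_mulmx (R : realFieldType) (V : normedModType R) (m n p : nat)
    (A : V -> 'M[R]_(m, n)) (B : V -> 'M[R]_(n, p)) dA dB (x v : V) :
  is_derive x v A dA -> is_derive x v B dB ->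
  is_derive x v (fun y => A y *m B y) (dA *m B x + A x *m dB).
Proof.
move=> /is_derive_mxP dAx /is_derive_mxP dBx; apply/is_derive_mxP => i j.
under eq_fun do rewrite mxE.
have dAB k := is_deriveM (dAx i k) (dBx k j).
apply: is_derive_eq (is_derive_sum_fun dAB) _.
rewrite !mxE -big_split; apply: eq_bigr => k _ /=.
by rewrite addrC [B x k j *: _]mulrC.
Qed.

Lemma is_derive_mxtrace (R : realFieldType) (V : normedModType R) (n : nat)
    (A : V -> 'M[R]_n) dA (x v : V) :
  is_derive x v A dA -> is_derive x v (fun y => \tr (A y)) (\tr dA).
Proof. by move=> /is_derive_mxP dAx; exact: is_derive_sum_fun. Qed.

Lemma is_derive_invmx (R : realFieldType) (V : normedModType R) (n : nat)
    (A : V -> 'M[R]_n) dA (x v : V) :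
  is_derive x v A dA -> (\forall y \near x, A y \in unitmx) ->
  is_derive x v (fun y => invmx (A y)) (- (invmx (A x) *m dA *m invmx (A x))).
Proof.
move=> dAx uA; have ux : A x \in unitmx := nbhs_singleton uA.
have /derivableP di : derivable (fun y => invmx (A y)) x v.
  by apply: derivable_invmx uA; have [] := dAx.
apply: (is_derive_eq di); have := is_derive_mulmx di dAx.
(* The product [invmx (A y) *m A y] is constant near [x]; comparing its zero derivative with the
   product rule determines the derivative of the inverse. *)
have d1 : is_derive x v (fun y => invmx (A y) *m A y) (0 : 'M[R]_n).
  apply: (near_eq_is_derive _ (is_derive_cst (1%:M : 'M[R]_n) x v)).
  by apply: filterS uA => y uy; rewrite mulVmx.
move=> /@derive_val; rewrite (@derive_val _ _ _ _ _ _ _ d1).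
move/(congr1 (fun M => M *m invmx (A x))); rewrite mul0mx mulmxDl mulmxK//.
by move/esym/eqP; rewrite addr_eq0 => /eqP.
Qed.

(** * Symmetry of the Ricci tensor *)

Lemma continuously_differentiableW (R : realType) (n r : nat)
    (V : normedModType R) (U : set 'rV[R]_n) (f : 'rV[R]_n -> V) :
  continuously_differentiable r.+1 U f -> continuously_differentiable r U f.
Proof.
elim: r f => [|r IH] f [f0 f1]; split=> // i.
by have [df /IH] := f1 i.
Qed.

Lemma continuously_differentiable_is_derive (R : realType) (n r : nat)
    (V : normedModType R) (U : set 'rV[R]_n) (f : 'rV[R]_n -> V) (i : 'I_n) x :
  continuously_differentiable r.+1 U f -> U x ->
  is_derive x (delta_mx 0 i) f (partial i f x).
Proof.
by case=> _ /(_ i)[df _] Ux; apply/derivableP/df; rewrite inE.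
Qed.

Lemma continuously_differentiable_partial (R : realType) (n r : nat)
    (V : normedModType R) (U : set 'rV[R]_n) (f : 'rV[R]_n -> V) (i : 'I_n) :
  continuously_differentiable r.+1 U f ->
  continuously_differentiable r U (partial i f).
Proof. by case=> _ /(_ i)[]. Qed.

Lemma partialC (R : realType) (n p q : nat) (U : set 'rV[R]_n)
    (f : 'rV[R]_n -> 'M[R]_(p, q)) (i j : 'I_n) (x : 'rV[R]_n) :
  open U -> U x -> continuously_differentiable 2 U f ->
  partial i (partial j f) x = partial j (partial i f) x.
Proof.
move=> oU Ux f2; apply/matrixP => a b.
have f1 l := continuously_differentiable_partial l f2.
have d1 l y : U y -> is_derive y (delta_mx 0 l) (fun z => f z a b)
    (partial l f y a b).
  by move=> /(continuously_differentiable_is_derive l f2)/is_derive_mxP.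
have d2 k l y : U y -> is_derive y (delta_mx 0 k) (fun z => partial l f z a b)
    (partial k (partial l f) y a b).
  by move=> /(continuously_differentiable_is_derive k (f1 l))/is_derive_mxP.
have c2 k l : {for x, continuous (fun y => partial k (partial l f) y a b)}.
  have [f0 _] := continuously_differentiable_partial k (f1 l).
  apply: (@continuous_comp _ _ _ (partial k (partial l f)) (fun M => M a b)).
    by apply: f0; rewrite inE.
  exact: coord_continuous.
exact: (schwarz_derive oU Ux (d1 j) (d1 i) (d2 i j) (d2 j i) (c2 i j) (c2 j i)).
Qed.

(** [christoffel] differentiates the entries of [h], whereas smoothness concerns [h] as a
    matrix-valued map; this passes between the two. *)
Lemma partial_coord (R : realType) (n p q : nat) (U : set 'rV[R]_n)
    (f : 'rV[R]_n -> 'M[R]_(p, q)) (i : 'I_n) (a : 'I_p) (b : 'I_q) x :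
  continuously_differentiable 1 U f -> U x ->
  partial i (fun y => f y a b) x = partial i f x a b.
Proof.
move=> f1 Ux; apply: derive_mx_coord.
by have [] := continuously_differentiable_is_derive i f1 Ux.
Qed.

Lemma christoffelC (R : realType) (n : nat) (U : set 'rV[R]_n)
    (h : 'rV[R]_n -> 'M[R]_n) (l i j : 'I_n) (x : 'rV[R]_n) :
  open U -> U x -> (forall y, U y -> (h y)^T = h y) ->
  christoffel h l i j x = christoffel h l j i x.
Proof.
move=> oU Ux sh; congr (_ * _); apply: eq_bigr => m _; congr (_ * (_ - _)).
  exact: addrC.
(* Symmetry of [h] is known only on [U], but [U] is a neighbourhood of [x], which suffices for
   derivatives at [x]. *)
apply: near_eq_derive; apply: filterS (open_nbhs_nbhs (conj oU Ux)) => y Uy.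
by rewrite -[in LHS]sh// mxE.
Qed.

(** This allows a partial derivative to be exchanged with the sum of the contracted Christoffel
    symbols. *)
Lemma derivable_christoffel (R : realType) (n : nat) (U : set 'rV[R]_n)
    (h : 'rV[R]_n -> 'M[R]_n) (l i j k : 'I_n) (x : 'rV[R]_n) :
  open U -> U x -> continuously_differentiable 2 U h ->
  (forall y, U y -> h y \in unitmx) ->
  derivable (christoffel h l i j) x (delta_mx 0 k).
Proof.
move=> oU Ux h2 uh; have nU := open_nbhs_nbhs (conj oU Ux).
have h1 a := continuously_differentiable_partial a h2.
have h1' := continuously_differentiableW h2.
have dcoord a b c : derivable (partial a (fun y => h y b c)) x (delta_mx 0 k).
  apply: (@near_eq_derivable _ _ _ (fun y => partial a h y b c)).
    by apply: filterS nU => y Uy; rewrite (partial_coord _ _ _ h1' Uy).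
  move: b c; apply/derivable_mxP.
  by have [] := continuously_differentiable_is_derive k (h1 a) Ux.
apply: derivableM; first exact: derivable_cst.
apply: derivable_sum_seq => m; apply: derivableM.
  move: l m; apply/derivable_mxP/derivable_invmx; last by apply: filterS nU.
  by have [] := continuously_differentiable_is_derive k h2 Ux.
by apply: derivableB; [apply: derivableD|].
Qed.

(* The classical [\sum_i Gamma^i_ik = d_k (log (sqrt (det h)))]. *)
Lemma christoffel_contract (R : realType) (n : nat) (U : set 'rV[R]_n)
    (h : 'rV[R]_n -> 'M[R]_n) (k : 'I_n) (x : 'rV[R]_n) :
  open U -> U x -> continuously_differentiable 1 U h ->
  (forall y, U y -> (h y)^T = h y) ->
  \sum_(i < n) christoffel h i i k x =
  2^-1 * \tr (invmx (h x) *m partial k h x).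
Proof.
move=> oU Ux h1 sh; rewrite -mulr_sumr; congr (_ * _).
have sdh a b c : partial a h x b c = partial a h x c b.
  rewrite -!(partial_coord _ _ _ h1 Ux); apply: near_eq_derive.
  apply: filterS (open_nbhs_nbhs (conj oU Ux)) => y Uy.
  by rewrite -[in LHS]sh// mxE.
have sinv a b : invmx (h x) a b = invmx (h x) b a.
  by rewrite -[in LHS](sh _ Ux) -trmx_inv mxE.
have -> : \tr (invmx (h x) *m partial k h x) =
    \sum_i \sum_m invmx (h x) i m * partial k h x i m.
  by apply: eq_bigr => i _; rewrite mxE; apply: eq_bigr => m _; rewrite sdh.
under eq_bigr do under eq_bigr do
  rewrite !(partial_coord _ _ _ h1 Ux) addrAC mulrDr.
under eq_bigr do rewrite big_split.
(* The first sum pairs the symmetric inverse of [h] with an expression antisymmetric in [i] and [m],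
   so it vanishes. *)
rewrite big_split /= [X in X + _](_ : _ = 0) ?add0r//.
under eq_bigr do under eq_bigr do rewrite mulrBr.
under eq_bigr do rewrite sumrB.
rewrite sumrB [X in _ - X]exchange_big /=.
apply/eqP; rewrite subr_eq0; apply/eqP.
apply: eq_bigr => i _; apply: eq_bigr => m _.
by rewrite sinv [partial i h x m k]sdh.
Qed.

(* With [Gamma^i_ik] written as a trace, its [d_j] derivative is symmetric in
   [j] and [k] by cyclicity of the trace and equality of mixed partials. *)
Lemma partial_christoffel_contractC (R : realType) (n : nat) (U : set 'rV[R]_n)
    (h : 'rV[R]_n -> 'M[R]_n) (j k : 'I_n) (x : 'rV[R]_n) :
  open U -> U x -> continuously_differentiable 2 U h ->
  (forall y, U y -> (h y)^T = h y) -> (forall y, U y -> h y \in unitmx) ->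
  \sum_(i < n) partial j (christoffel h i i k) x =
  \sum_(i < n) partial k (christoffel h i i j) x.
Proof.
move=> oU Ux h2 sh uh; have nU := open_nbhs_nbhs (conj oU Ux).
have nuh : \forall y \near x, h y \in unitmx by apply: filterS nU.
have h1' := continuously_differentiableW h2.
have dE a b : \sum_(i < n) partial a (christoffel h i i b) x =
    2^-1 * \tr (- (invmx (h x) *m partial a h x *m invmx (h x)) *m partial b h x
                + invmx (h x) *m partial a (partial b h) x).
  transitivity (partial a (fun y => \sum_(i < n) christoffel h i i b y) x).
    rewrite /partial -fct_sumE derive_sum// => i.
    exact: (derivable_christoffel oU).
  (* The trace formula holds on all of [U], hence near [x], so it may be substituted under the
     derivative. *)
  transitivity
    (partial a (fun y => 2^-1 * \tr (invmx (h y) *m partial b h y)) x).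
    apply: near_eq_derive; apply: filterS nU => y Uy.
    exact: (christoffel_contract _ oU).
  have dh := continuously_differentiable_is_derive a h2 Ux.
  have di := is_derive_invmx dh nuh.
  have ddh := continuously_differentiable_is_derive a
    (continuously_differentiable_partial b h2) Ux.
  have dt := is_derive_mxtrace (is_derive_mulmx di ddh).
  rewrite /partial (@derive_val _ _ _ _ _ _ _ (is_deriveZ 2^-1 dt)).
  by [].
have trC (G A B C D : 'M[R]_n) : C = D ->
    \tr (- (G *m A *m G) *m B + G *m C) = \tr (- (G *m B *m G) *m A + G *m D).
  move=> ->; rewrite !mxtraceD !mulNmx !raddfN /=; congr (- _ + _).
  by rewrite -[G *m A *m G *m B]mulmxA mxtrace_mulC !mulmxA.
apply: etrans (dE j k) _; apply: etrans (esym (dE k j)).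
exact: congr1 (trC _ _ _ _ _ (partialC j k oU Ux h2)).
Qed.

(** The Ricci tensor is split into four sums. The first and third are symmetric because Christoffel
    symbols are symmetric in their lower indices, the second by [partial_christoffel_contractC], the
    fourth by renaming summation indices. *)
Lemma ricci_symmetric (R : realType) (n : nat) (U : set 'rV[R]_n)
    (h : 'rV[R]_n -> 'M[R]_n) (x : 'rV[R]_n) :
  open U -> U x -> continuously_differentiable 2 U h ->
  (forall y, U y -> (h y)^T = h y) -> (forall y, U y -> h y \in unitmx) ->
  (ricci h x)^T = ricci h x.
Proof.
move=> oU Ux h2 sh uh; have nU := open_nbhs_nbhs (conj oU Ux).
have ricciE a b : ricci h x a b =
    \sum_(i < n) partial i (christoffel h i a b) x
    - \sum_(i < n) partial a (christoffel h i i b) x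
    + (\sum_(i < n) \sum_(m < n) christoffel h i i m x * christoffel h m a b x
       - \sum_(i < n) \sum_(m < n)
           christoffel h i a m x * christoffel h m i b x).
  rewrite mxE big_split; congr (_ + _); first exact: sumrB.
  by rewrite -sumrB; apply: eq_bigr => i _; exact: sumrB.
apply/matrixP => k j; rewrite mxE.
apply: etrans (ricciE j k) _; apply: etrans (esym (ricciE k j)).
apply: (congr2 +%R); apply: (congr2 (fun s t => s - t)).
- apply: eq_bigr => i _; apply: near_eq_derive.
  by apply: filterS nU => y Uy; exact: (christoffelC _ _ _ oU).
- exact: (partial_christoffel_contractC _ _ oU).
- apply: eq_bigr => i _; apply: eq_bigr => m _; congr (_ * _).
  exact: (christoffelC _ _ _ oU).
(* Swapping [i] and [m] exchanges the two factors, up to the order of their lower indices. *)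
- rewrite exchange_big; apply: eq_bigr => i _; apply: eq_bigr => m _ /=.
  by rewrite mulrC; congr (_ * _); exact: (christoffelC _ _ _ oU).
Qed.

(** * Positive Ricci eigenvalues on a manifold *)

Theorem proposition2p10 (R : realType) (n : nat) (M : smooth_manifold R n)
  (g : riemannian_metric M) (k : nat) (hk : (k < n)%N)
  (hEin : ein_positive g k) :
  forall (p : M) (a : chart R n M), atlas a -> chart_dom a p ->
    (k + 1 <= num_positive_eigenvalues (ricci_operator (g a) (chart_map a p)))%N.
Proof.
move=> p a aA ap; rewrite addn1.
have Up : chart_image a (chart_map a p) by exists p.
(* In the chart [a], the pencil consists of the Ricci matrix as [S] and the metric matrix as [G],
   and the form assumed positive is then [ein] by definition. *)
apply: num_positive_eigenvalues_pencil hk _.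
- apply: (@ricci_symmetric _ _ (chart_image a)) => //.
  + exact: chart_image_open.
  + exact: metric_smooth.
  + by move=> y Uy; exact: metric_symmetric.
  + move=> y Uy; apply: positive_definite_unitmx; exact: metric_positive.
- exact: metric_symmetric.
- exact: metric_positive.
- exact: hEin.
Qed.
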